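(* Consider the system $x_{k+1}=A(w_k)x_k+B(w_k)u_k$ under the model predictive control law $u_k=\pi^{MPC}(x_k)$ with horizon $N\ge 1$ and terminal weight matrix $P$. Suppose that $P=P^T\succ 0$ and that there exists a matrix $F\in\mathbb{R}^{N_u\times N_x}$ such that $$\sum_{j=1}^L q_l(j)\,(A_j+B_jF)^TP(A_j+B_jF)-P+(F^TRF+Q)\prec 0$$ for all $l\in\{1,\dots,\mathrm{cardinality}(\mathcal{U}^{\mathrm{poly},V}(p))\}$, where $\mathcal{U}^{\mathrm{poly},V}(p)$ is the set of vertices of the polytope $\mathcal{U}^{\mathrm{poly}}(p)$, $q_l$ is its $l$-th element, and $q_l(j)$ is the $j$-th component of $q_l$. Then the closed-loop system $x_{k+1}=A(w_k)x_k+B(w_k)\pi^{MPC}(x_k)$ is Uniformly Globally Risk-Sensitive Exponentially Stable (UGRSES).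
   Context: System. $x_k\in\mathbb{R}^{N_x}$, $u_k\in\mathbb{R}^{N_u}$ (unconstrained), deterministic $x_0$, and disturbances $w_k\in\mathcal{W}=\{w^{[1]},\dots,w^{[L]}\}$, independent of the process history and of $(x_k,u_k)$, with time-invariant probability mass function $p=(p(1),\dots,p(L))$, $p(j)=\mathbb{P}(w_k=w^{[j]})>0$. $A_j=A(w^{[j]})\in\mathbb{R}^{N_x\times N_x}$, $B_j=B(w^{[j]})\in\mathbb{R}^{N_x\times N_u}$. Risk measure. $\Delta^L=\{q\in\mathbb{R}^L: q\ge 0,\ \sum_{j=1}^L q(j)=1\}$. A fixed nonempty polytope $\mathcal{U}^{\mathrm{poly}}(p)=\{q\in\Delta^L: S^I q\le T^I,\ S^E q=T^E\}$ is given, where the matrices $S^I,S^E$ and vectors $T^I,T^E$ may depend on $p$ but not on time or on the state. The one-step (Markov polytopic) risk measure of a function $g$ of the next state, given the current state $x$ and control $u$, is $$\rho(g)=\max_{q\in\mathcal{U}^{\mathrm{poly}}(p)}\sum_{j=1}^L q(j)\,g(A_jx+B_ju).$$ The associated Markov dynamic polytopic risk measure is the nested composition $\rho_{k,k+N}(Z_k,\dots,Z_{k+N})=Z_k+\rho(Z_{k+1}+\rho(Z_{k+2}+\cdots+\rho(Z_{k+N})\cdots))$, where $Z_i$ is a function of $x_i$ and the $\rho$ applied to a quantity at time $i+1$ is evaluated conditionally on $x_i$. Cost. $c(x,u)=x^TQx+u^TRu$ with $Q=Q^T\succ0$, $R=R^T\succ0$ given. MPC problem. For a state $x\in\mathbb{R}^{N_x}$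 and policies $\pi_0,\dots,\pi_{N-1}:\mathbb{R}^{N_x}\to\mathbb{R}^{N_u}$, let $J(x,\pi_0,\dots,\pi_{N-1},P)=\rho_{k,k+N}(c(x_0,\pi_0(x_0)),\dots,c(x_{N-1},\pi_{N-1}(x_{N-1})),x_N^TPx_N)$, where $x_0=x$ and $x_{h+1}=A(w_{k+h})x_h+B(w_{k+h})\pi_h(x_h)$. Equivalently, $J=V_0(x)$, where $V_N(y)=y^TPy$ and $V_h(y)=c(y,\pi_h(y))+\max_{q\in\mathcal{U}^{\mathrm{poly}}(p)}\sum_{j}q(j)V_{h+1}(A_jy+B_j\pi_h(y))$ for $h=N-1,\dots,0$. The MPC problem at state $x$ is to minimize $J(x,\pi_0,\dots,\pi_{N-1},P)$ over $(\pi_0,\dots,\pi_{N-1})$. If $(\pi_0^*,\dots,\pi_{N-1}^* )$ is a minimizer for the initial state $x$, the model predictive control law is $\pi^{MPC}(x)=\pi_0^*(x)$. This problem is solved anew at each time $k$ with $x=x_k$, and the resulting law is time-invariant. UGRSES. The closed-loop system is Uniformly Globally Risk-Sensitive Exponentially Stable if there exist constants $c\ge 0$ and $\lambda\in[0,1)$ (here $c$ is a scalar, not the stage cost) such that for all initial conditions $x_0\in\mathbb{R}^{N_x}$ and all $k\in\mathbb{N}$, $\rho_{0,k}(0,\dots,0,x_k^Tx_k)\le c\,\lambda^k\,x_0^Tx_0$. Here $\rho_{0,k}(0,\dots,0,x_k^Tx_k)=(T^kg_0)(x_0)$ with $g_0(x)=x^Tx$ and $(Tg)(x)=\max_{q\in\mathcal{U}^{\mathrm{poly}}(p)}\sum_j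 q(j)\,g(A_jx+B_j\pi^{MPC}(x))$. *)

(* Defs.v *)
From HB Require Import structures.
From mathcomp Require Import all_boot all_order all_algebra.
From mathcomp Require Import all_classical all_reals all_analysis.

Set Implicit Arguments.
Unset Strict Implicit.
Unset Printing Implicit Defensive.

Import Order.TTheory GRing.Theory Num.Theory numFieldNormedType.Exports.
Local Open Scope classical_set_scope.
Local Open Scope ring_scope.

Definition qform (K : realType) n (M : 'M[K]_n) (x : 'cV[K]_n) : K :=
  (x^T *m M *m x) 0 0.

Definition sqnorm (K : realType) n (x : 'cV[K]_n) : K := (x^T *m x) 0 0.

Definition posdef (K : realType) n (M : 'M[K]_n) : Prop :=
  M^T = M /\ forall x : 'cV[K]_n, x != 0 -> 0 < qform M x.

Definition negdef (K : realType) n (M : 'M[K]_n) : Prop := posdef (- M).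

Definition positive_pmf (K : realType) L (p : 'rV[K]_L) : Prop :=
  (forall j, 0 < p 0 j) /\ \sum_j p 0 j = 1.

Definition simplex (K : realType) L : set 'rV[K]_L :=
  [set q | (forall j, 0 <= q 0 j) /\ \sum_j q 0 j = 1].

Definition polytope (K : realType) L mI mE
    (SI : 'M[K]_(mI, L)) (TI : 'cV[K]_mI)
    (SE : 'M[K]_(mE, L)) (TE : 'cV[K]_mE) : set 'rV[K]_L :=
  [set q | [/\ simplex q, forall i, (SI *m q^T) i 0 <= TI i 0
             & SE *m q^T = TE]].

(* The vertices of a polytope are its extreme points. *)
Definition vertices (K : realType) L (U : set 'rV[K]_L) : set 'rV[K]_L :=
  [set q | U q /\ forall (a b : 'rV[K]_L) (t : K), U a -> U b -> 0 < t < 1 ->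
             q = t *: a + (1 - t) *: b -> a = b].

Section Risk.
Variables (K : realType) (L Nx Nu : nat) (U : set 'rV[K]_L).
Variables (A : 'I_L -> 'M[K]_Nx) (B : 'I_L -> 'M[K]_(Nx, Nu)).

Definition expected_next (x : 'cV[K]_Nx) (u : 'cV[K]_Nu) (g : 'cV[K]_Nx -> K)
    (q : 'rV[K]_L) : K :=
  \sum_(j < L) q 0 j * g (A j *m x + B j *m u).

(* For a nonempty polytope U this supremum is a maximum, see
   [one_step_riskP] below. *)
Definition one_step_risk (x : 'cV[K]_Nx) (u : 'cV[K]_Nu)
    (g : 'cV[K]_Nx -> K) : K :=
  sup [set expected_next x u g q | q in U].

(* [dyn_risk n pi Z k x] is the nested composition
   Z_k + rho(Z_{k+1} + ... + rho(Z_{k+n}) ...) at the state x at time k, the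
   system being driven by u_i = pi_i(x_i). *)
Fixpoint dyn_risk (n : nat) (pi : nat -> 'cV[K]_Nx -> 'cV[K]_Nu)
    (Z : nat -> 'cV[K]_Nx -> K) (k : nat) (x : 'cV[K]_Nx) : K :=
  if n is n'.+1 then
    Z k x + one_step_risk x (pi k x) (dyn_risk n' pi Z k.+1)
  else Z k x.

Definition stage_cost (Q : 'M[K]_Nx) (R : 'M[K]_Nu)
    (x : 'cV[K]_Nx) (u : 'cV[K]_Nu) : K :=
  qform Q x + qform R u.

(* Only the policies pi_0, ..., pi_{N-1} matter. *)
Definition mpc_cost (Q : 'M[K]_Nx) (R : 'M[K]_Nu) (N : nat) (P : 'M[K]_Nx)
    (x : 'cV[K]_Nx) (pi : nat -> 'cV[K]_Nx -> 'cV[K]_Nu) : K :=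
  dyn_risk N pi
    (fun h y => if (h < N)%N then stage_cost Q R y (pi h y) else qform P y)
    0 x.

Definition mpc_minimizer Q R N P (x : 'cV[K]_Nx)
    (pi : nat -> 'cV[K]_Nx -> 'cV[K]_Nu) : Prop :=
  forall pi', mpc_cost Q R N P x pi <= mpc_cost Q R N P x pi'.

(* The minimizing policies may be chosen independently at each state x. *)
Definition mpc_law Q R N P (piMPC : 'cV[K]_Nx -> 'cV[K]_Nu) : Prop :=
  forall x, exists2 pi, mpc_minimizer Q R N P x pi & piMPC x = pi 0%N x.

Definition UGRSES (kappa : 'cV[K]_Nx -> 'cV[K]_Nu) : Prop :=
  exists c lambda : K, [/\ 0 <= c, 0 <= lambda < 1 &
    forall (x0 : 'cV[K]_Nx) (k : nat),
      dyn_risk k (fun=> kappa) (fun i x => if (i < k)%N then 0 else sqnorm x)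
        0 x0 <= c * lambda ^+ k * sqnorm x0].

End Risk.

Lemma weighted_sum_continuous (K : realType) L (a : 'I_L -> K) :
  continuous (fun q : 'rV[K]_L => \sum_j q 0 j * a j).
Proof.
apply: continuous_big; first exact: add_continuous.
move=> j _ q; apply: (@cvgMr_tmp _ _ (nbhs q)).
exact: coord_continuous.
Qed.

Lemma polytope_compact (K : realType) L mI mE
    (SI : 'M[K]_(mI, L)) (TI : 'cV[K]_mI)
    (SE : 'M[K]_(mE, L)) (TE : 'cV[K]_mE) :
  compact (polytope SI TI SE TE).
Proof.
have linc := @weighted_sum_continuous K L.
have mxE' m (S : 'M[K]_(m, L)) i (q : 'rV[K]_L) :
    (S *m q^T) i 0 = \sum_j q 0 j * S i j.
  by rewrite mxE; apply: eq_bigr => j _; rewrite mxE mulrC.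
apply: (@subclosed_compact _ _
    [set v : 'rV[K]_L | forall i, `[0 : K, 1]%classic (v ord0 i)]).
- have -> : polytope SI TI SE TE =
      (\bigcap_(j in [set: 'I_L]) [set q | 0 <= q 0 j]) `&`
      [set q | \sum_j q 0 j * 1 = 1] `&`
      (\bigcap_(i in [set: 'I_mI]) [set q | \sum_j q 0 j * SI i j <= TI i 0]) `&`
      (\bigcap_(i in [set: 'I_mE]) [set q | \sum_j q 0 j * SE i j = TE i 0]).
    have s1 (q : 'rV[K]_L) : \sum_j q 0 j * 1 = \sum_j q 0 j.
      by apply: eq_bigr => j _; rewrite mulr1.
    apply/seteqP; split => q /=.
      move=> [[q0 q1] qI qE]; split; first split; first split.
      + by move=> j _ /=.
      + by rewrite s1.
      + by move=> i _ /=; rewrite -mxE'.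
      + by move=> i _ /=; rewrite -mxE' qE.
    move=> [[[q0 q1] qI] qE]; split.
    + by split=> [j|]; [exact: q0|rewrite -s1].
    + by move=> i; rewrite mxE'; exact: qI.
    + by apply/matrixP => i j; rewrite (ord1 j) mxE'; exact: qE.
  apply: closedI; first apply: closedI; first apply: closedI.
  + apply: closed_bigI => j _.
    apply: (@preimage_closed _ _ (fun q : 'rV[K]_L => q 0 j) [set y | 0 <= y]).
      by move=> q _; exact: coord_continuous.
    exact: closed_ge.
  + apply: (@preimage_closed _ _ (fun q : 'rV[K]_L => \sum_j q 0 j * 1)
      [set y | y = 1]); last exact: closed_eq.
    by move=> q _; exact: linc.
  + apply: closed_bigI => i _.
    apply: (@preimage_closed _ _ (fun q : 'rV[K]_L => \sum_j q 0 j * SI i j)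
      [set y | y <= TI i 0]); last exact: closed_le.
    by move=> q _; exact: linc.
  + apply: closed_bigI => i _.
    apply: (@preimage_closed _ _ (fun q : 'rV[K]_L => \sum_j q 0 j * SE i j)
      [set y | y = TE i 0]); last exact: closed_eq.
    by move=> q _; exact: linc.
- apply: (@rV_compact _ _ (fun=> `[0 : K, 1]%classic)) => _.
  exact: segment_compact.
- move=> q [[q0 q1] _ _] i /=; rewrite in_itv /= q0 /= -q1 (bigD1 i) //=.
  by rewrite lerDl sumr_ge0.
Qed.

Lemma one_step_riskP (K : realType) L Nx Nu mI mE
    (SI : 'M[K]_(mI, L)) (TI : 'cV[K]_mI)
    (SE : 'M[K]_(mE, L)) (TE : 'cV[K]_mE)
    (A : 'I_L -> 'M[K]_Nx) (B : 'I_L -> 'M[K]_(Nx, Nu)) x u g :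
  let U := polytope SI TI SE TE in
  U !=set0 ->
  (exists2 q, U q & one_step_risk U A B x u g = expected_next A B x u g q) /\
  (forall q, U q -> expected_next A B x u g q <= one_step_risk U A B x u g).
Proof.
move=> U U0.
have cf : {within U, continuous (expected_next A B x u g)}.
  exact/continuous_subspaceT/weighted_sum_continuous.
have [q0 /set_mem Uq0 q0max] :=
  compact_EVT_max U0 (@polytope_compact _ _ _ _ SI TI SE TE) cf.
have ub : ubound [set expected_next A B x u g q | q in U]
    (expected_next A B x u g q0).
  by move=> _ [q Uq <-]; apply: q0max; exact/mem_set.
have eqs : one_step_risk U A B x u g = expected_next A B x u g q0.
  apply/eqP; rewrite eq_le; apply/andP; split.
    by apply: ge_sup => //; exists (expected_next A B x u g q0), q0.
  by apply: ub_le_sup; [exists (expected_next A B x u g q0)|exists q0].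
split; first by exists q0.
by move=> q Uq; rewrite eqs; apply: ub; exists q.
Qed.

(* Main.v *)
Require Import Defs.
From HB Require Import structures.
From mathcomp Require Import all_boot all_order all_algebra.
From mathcomp Require Import all_classical all_reals all_analysis.
From mathcomp Require Import ring lra.

Import Order.TTheory GRing.Theory Num.Theory numFieldNormedType.Exports.
Local Open Scope classical_set_scope.
Local Open Scope ring_scope.

(** The optimal cost [V] of the MPC problem is a Lyapunov function for the closed
loop.  Writing [rho] for the one-step risk and [alpha], [beta] for constants
with [alpha |x|^2 <= x^T Q x] and [x^T P x <= beta |x|^2]:

- [V x <= x^T P x], because the linear feedback [F] is an admissible policy
  whose cost is at most [x^T P x] whatever the horizon.  This holds because
  [c(x, F x) + rho (x^T P x) <= x^T P x]: the hypothesis gives it for the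
  vertices of the polytope, and the expectation in [rho], being linear in [q],
  is maximal at a vertex ([linear_max_at_vertex], [terminal_decrease]).
- [V x >= x^T Q x], the first stage cost, since all the others are nonnegative.
- Along the closed loop [rho V <= V x - x^T Q x].  Indeed the optimal policy at
  [x], without its first step and followed by [F] at the end, is a candidate at
  the successor states, and replacing there the terminal cost by one more step
  under [F] does not increase the cost ([mpc_cost_shifted]).

Hence [rho V <= (1 - alpha / beta) V], which is iterated by monotonicity and
positive homogeneity of [rho] ([lyapunov_UGRSES]).  The constant [alpha + beta]
is used for [beta], so that the rate is in [[0, 1)]. *)

(** * Quadratic forms *)

Section QuadraticForms.
Variables (K : realType) (n : nat).
Implicit Types (M : 'M[K]_n) (x : 'cV[K]_n).

Lemma qformE M x : qform M x = \sum_j \sum_i x i 0 * M i j * x j 0.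
Proof.
rewrite /qform mxE; apply: eq_bigr => j _; rewrite mxE mulr_suml.
by apply: eq_bigr => i _; rewrite mxE.
Qed.

Lemma sqnormE x : sqnorm x = \sum_i x i 0 ^+ 2.
Proof.
by rewrite /sqnorm mxE; apply: eq_bigr => i _; rewrite mxE expr2.
Qed.

Lemma qformD M M' x : qform (M + M') x = qform M x + qform M' x.
Proof. by rewrite /qform mulmxDr mulmxDl mxE. Qed.

Lemma qformN M x : qform (- M) x = - qform M x.
Proof. by rewrite /qform mulmxN mulNmx mxE. Qed.

Lemma qform_lincomb L (c : 'I_L -> K) (M : 'I_L -> 'M[K]_n) x :
  qform (\sum_j c j *: M j) x = \sum_j c j * qform (M j) x.
Proof.
rewrite /qform mulmx_sumr mulmx_suml summxE; apply: eq_bigr => j _.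
by rewrite -scalemxAr -scalemxAl mxE.
Qed.

Lemma qform_congr m (M : 'M[K]_m) (C : 'M[K]_(m, n)) x :
  qform (C^T *m M *m C) x = qform M (C *m x).
Proof. by rewrite /qform trmx_mul !mulmxA. Qed.

Lemma qform0 M : qform M 0 = 0.
Proof. by rewrite /qform mulmx0 mxE. Qed.

Lemma qformZ M (a : K) x : qform M (a *: x) = a ^+ 2 * qform M x.
Proof.
rewrite !qformE mulr_sumr; apply: eq_bigr => j _.
by rewrite mulr_sumr; apply: eq_bigr => i _; rewrite !mxE; ring.
Qed.

Lemma posdef_ge0 M x : posdef M -> 0 <= qform M x.
Proof.
move=> [_ Mgt0]; have [->|/Mgt0/ltW//] := eqVneq x 0.
by rewrite qform0.
Qed.

Lemma sqr_coord_le_sqnorm x i : x i 0 ^+ 2 <= sqnorm x.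
Proof. by rewrite sqnormE (bigD1 i) //= lerDl sumr_ge0 // => j _; exact: sqr_ge0. Qed.

Lemma sqnorm_ge0 x : 0 <= sqnorm x.
Proof. by rewrite sqnormE sumr_ge0 // => i _; exact: sqr_ge0. Qed.

Lemma sqnorm_eq0 x : sqnorm x = 0 -> x = 0.
Proof.
move=> x0; apply/matrixP => i j; rewrite (ord1 j) mxE; apply/eqP.
by rewrite -(sqrf_eq0 (x i 0)) eq_le sqr_ge0 -x0 sqr_coord_le_sqnorm.
Qed.

Lemma sqnorm0 : sqnorm (0 : 'cV[K]_n) = 0.
Proof. by rewrite /sqnorm mulmx0 mxE. Qed.

Lemma sqnormZ (a : K) x : sqnorm (a *: x) = a ^+ 2 * sqnorm x.
Proof. by rewrite !sqnormE mulr_sumr; apply: eq_bigr => i _; rewrite mxE exprMn. Qed.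

Lemma sqnorm_trE (v : 'rV[K]_n) : sqnorm v^T = \sum_i v 0 i ^+ 2.
Proof. by rewrite sqnormE; apply: eq_bigr => i _; rewrite mxE. Qed.

Lemma sqnorm_tr_continuous : continuous (fun v : 'rV[K]_n => sqnorm v^T).
Proof.
under eq_fun do rewrite sqnorm_trE.
apply: continuous_big; first exact: add_continuous.
move=> i _ v; under eq_fun do rewrite expr2.
by apply: (@cvgM _ _ (nbhs v)); exact: coord_continuous.
Qed.

Lemma qform_le_sqnorm M : exists2 b, 0 <= b & forall x, qform M x <= b * sqnorm x.
Proof.
exists (\sum_j \sum_i `|M i j|) => [|x].
  by apply: sumr_ge0 => j _; apply: sumr_ge0.
rewrite qformE mulr_suml; apply: ler_sum => j _.
rewrite mulr_suml; apply: ler_sum => i _.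
rewrite (le_trans (ler_norm _)) // !normrM mulrAC mulrC ler_wpM2l //.
have := sqr_coord_le_sqnorm x i; have := sqr_coord_le_sqnorm x j.
rewrite -(real_normK (num_real (x i 0))) -(real_normK (num_real (x j 0))).
by move: `|x i 0| `|x j 0| => a b; nra.
Qed.

(** The constant is the minimum of the form on the Euclidean unit sphere, which
is compact; the general case follows by scaling. *)
Lemma posdef_coercive M : posdef M ->
  exists2 a, 0 < a & forall x, a * sqnorm x <= qform M x.
Proof.
move=> [_ Mgt0].
(* In dimension zero the sphere is empty and there is nothing to minimize. *)
have [[x0 x0N0]|noN0] := pselect (exists x : 'cV[K]_n, x != 0); last first.
  exists 1 => // x; have [->|xN0] := eqVneq x 0; last by case: noN0; exists x.
  by rewrite qform0 sqnorm0 mulr0.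
have sq_gt0 x : x != 0 -> 0 < sqnorm x.
  move=> xN0; rewrite lt_neqAle sqnorm_ge0 andbT eq_sym.
  by apply: contraNneq xN0 => /sqnorm_eq0 ->.
pose S := [set v : 'rV[K]_n | sqnorm v^T = 1].
have normalized x : x != 0 -> S ((Num.sqrt (sqnorm x))^-1 *: x)^T.
  move=> xN0; rewrite /S/= trmxK sqnormZ exprVn sqr_sqrtr ?sqnorm_ge0//.
  by rewrite mulVf // gt_eqF // sq_gt0.
have cS : compact S.
  apply: (@subclosed_compact _ _
      [set v : 'rV[K]_n | forall i, `[-1 : K, 1]%classic (v ord0 i)]).
  - apply: (@preimage_closed _ _ (fun v : 'rV[K]_n => sqnorm v^T)
      [set y | y = 1]); last exact: closed_eq.
    by move=> v _; exact: sqnorm_tr_continuous.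
  - apply: (@rV_compact _ _ (fun=> `[-1 : K, 1]%classic)) => _.
    exact: segment_compact.
  - move=> v v1 i /=; rewrite in_itv /= -ler_norml.
    rewrite -(@ler_pXn2r _ 2) ?nnegrE // expr1n real_normK ?num_real // -v1.
    by apply: le_trans (sqr_coord_le_sqnorm v^T i); rewrite mxE.
have cM : continuous (fun v : 'rV[K]_n => qform M v^T).
  have -> : (fun v : 'rV[K]_n => qform M v^T) =
      (fun v => \sum_j \sum_i v 0 i * M i j * v 0 j).
    apply/funext => v; rewrite qformE; apply: eq_bigr => j _.
    by apply: eq_bigr => i _; rewrite !mxE.
  apply: continuous_big => [|j _]; first exact: add_continuous.
  apply: continuous_big => [|i _ v]; first exact: add_continuous.
  apply: (@cvgM _ _ (nbhs v)); last exact: coord_continuous.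
  by apply: (@cvgMr_tmp _ _ (nbhs v)); exact: coord_continuous.
have S0 : S !=set0 by exists ((Num.sqrt (sqnorm x0))^-1 *: x0)^T; exact: normalized.
have [v /set_mem Sv vmin] := compact_EVT_min S0 cS (continuous_subspaceT cM).
exists (qform M v^T).
  apply: Mgt0; apply/eqP => v0; move: Sv; rewrite /S/= v0 => /eqP.
  by rewrite sqnorm0 eq_sym oner_eq0.
move=> x; have [->|xN0] := eqVneq x 0.
  by rewrite qform0 sqnorm0 mulr0.
have := vmin _ (mem_set (normalized _ xN0)).
rewrite trmxK qformZ exprVn sqr_sqrtr ?sqnorm_ge0//.
by rewrite ler_pdivlMl ?sq_gt0// mulrC.
Qed.

End QuadraticForms.

(** * Linear functionals on a compact set *)

(** Among the maximizers of the functional, take one of maximal Euclidean norm.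
If it is a proper convex combination of two points of [U], these are maximizers
as well, so neither of them has a larger norm, and strict convexity of the
squared norm forces them to be equal. *)
Lemma linear_max_at_vertex (K : realType) L (U : set 'rV[K]_L) (a : 'I_L -> K) :
  compact U -> U !=set0 ->
  exists2 v, vertices U v &
    forall q, U q -> \sum_j q 0 j * a j <= \sum_j v 0 j * a j.
Proof.
move=> cU U0; pose f (q : 'rV[K]_L) := \sum_j q 0 j * a j.
have fcont : continuous f by exact: weighted_sum_continuous.
have [q0 /set_mem Uq0 q0max] := compact_EVT_max U0 cU (continuous_subspaceT fcont).
pose G := U `&` [set q | f q0 <= f q].
have cG : compact G.
  apply: compact_closedI => //.
  apply: (@preimage_closed _ _ f [set y | f q0 <= y]); last exact: closed_ge.
  by move=> q _; exact: fcont.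
have G0 : G !=set0 by exists q0; split => /=.
have [v /set_mem [Uv fv] vmax] :=
  compact_EVT_max G0 cG (continuous_subspaceT (@sqnorm_tr_continuous K L)).
exists v; last first.
  by move=> q Uq; apply: le_trans fv; apply: q0max; exact: mem_set.
split => // b c t Ub Uc /andP[t0 t1] vE.
have fE : f v = t * f b + (1 - t) * f c.
  rewrite /f !mulr_sumr -big_split/=; apply: eq_bigr => j _.
  by rewrite vE !mxE; ring.
have fb := q0max _ (mem_set Ub); have fc := q0max _ (mem_set Uc).
have Gb : G b by split => //=; move: fv; rewrite /= fE => fv; nra.
have Gc : G c by split => //=; move: fv; rewrite /= fE => fv; nra.
have nb := vmax _ (mem_set Gb); have nc := vmax _ (mem_set Gc).
(* Strict convexity of the squared norm, with its defect. *)
have nE : sqnorm v^T =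
    t * sqnorm b^T + (1 - t) * sqnorm c^T - t * (1 - t) * sqnorm (b - c)^T.
  rewrite !sqnorm_trE !mulr_sumr -sumrN -!big_split/=; apply: eq_bigr => j _.
  by rewrite vE !mxE; ring.
have bc0 : sqnorm (b - c)^T = 0.
  apply/eqP; rewrite eq_le sqnorm_ge0 andbT.
  rewrite -(@pmulr_rle0 _ (t * (1 - t))) ?mulr_gt0 ?subr_gt0//.
  by nra.
by move/sqnorm_eq0/(congr1 trmx): bc0; rewrite trmxK trmx0 => /eqP; rewrite subr_eq0 => /eqP.
Qed.

(** * Polytopic risk and Lyapunov functions *)

Section Risk.
Variables (K : realType) (L Nx Nu mI mE : nat).
Variables (SI : 'M[K]_(mI, L)) (TI : 'cV[K]_mI).
Variables (SE : 'M[K]_(mE, L)) (TE : 'cV[K]_mE).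
Variables (A : 'I_L -> 'M[K]_Nx) (B : 'I_L -> 'M[K]_(Nx, Nu)).
Let U := polytope SI TI SE TE.
Hypothesis U0 : U !=set0.
Local Notation rho := (one_step_risk U A B).
Implicit Types (x : 'cV[K]_Nx) (u : 'cV[K]_Nu) (g : 'cV[K]_Nx -> K).

Lemma one_step_risk_le x u g m :
  (forall q, U q -> expected_next A B x u g q <= m) -> rho x u g <= m.
Proof.
by move=> gm; have [[q Uq ->] _] := one_step_riskP A B x u g U0; exact: gm.
Qed.

Lemma le_one_step_risk x u g h : (forall y, g y <= h y) -> rho x u g <= rho x u h.
Proof.
move=> gh; apply: one_step_risk_le => q Uq.
have [_ /(_ q Uq)] := one_step_riskP A B x u h U0; apply: le_trans.
by apply: ler_sum => j _; rewrite ler_wpM2l //; case: Uq => -[].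
Qed.

Lemma one_step_risk_ge0 x u g : (forall y, 0 <= g y) -> 0 <= rho x u g.
Proof.
move=> g0; have [[q Uq ->] _] := one_step_riskP A B x u g U0.
by apply: sumr_ge0 => j _; rewrite mulr_ge0 //; case: Uq => -[].
Qed.

Lemma one_step_riskZ x u g c : 0 <= c ->
  rho x u (fun y => c * g y) <= c * rho x u g.
Proof.
move=> c0; apply: one_step_risk_le => q Uq.
have [_ /(_ q Uq) gq] := one_step_riskP A B x u g U0.
apply: le_trans (ler_wpM2l c0 gq); rewrite /expected_next mulr_sumr.
by apply: ler_sum => j _; rewrite mulrCA.
Qed.

Lemma dyn_risk_ge0 n pi Z k x : (forall h y, 0 <= Z h y) ->
  0 <= dyn_risk U A B n pi Z k x.
Proof.
move=> Z0; elim: n k x => [|n IH] k x /=; first exact: Z0.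
by rewrite addr_ge0 // one_step_risk_ge0.
Qed.

(** By induction on the number [n] of remaining steps, the risk of the final
squared norm is at most [l ^+ n / a * V x]: the lower bound on [V] starts the
induction, and the upper bound is used once, at the initial state. *)
Lemma lyapunov_UGRSES kappa (V : 'cV[K]_Nx -> K) (a b l : K) :
  0 < a -> 0 <= b -> 0 <= l < 1 ->
  (forall x, a * sqnorm x <= V x <= b * sqnorm x) ->
  (forall x, rho x (kappa x) V <= l * V x) ->
  UGRSES U A B kappa.
Proof.
move=> a0 b0 l01 Vab Vl; exists (b / a), l; split=> //.
  by rewrite divr_ge0 // ltW.
have /andP[l0 _] := l01; move=> x0 k.
suff main n i x : (n + i = k)%N -> dyn_risk U A B n (fun=> kappa)
    (fun i x => if (i < k)%N then 0 else sqnorm x) i x <= l ^+ n / a * V x.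
  apply: le_trans (main k 0%N x0 _) _; first by rewrite addn0.
  have -> : b / a * l ^+ k * sqnorm x0 = l ^+ k / a * (b * sqnorm x0) by ring.
  rewrite ler_wpM2l ?divr_ge0 ?exprn_ge0 ?(ltW a0)//.
  by have /andP[] := Vab x0.
elim: n i x => [|n IH] i x /= nik.
  rewrite -nik ltnn expr0 mul1r ler_pdivlMl //.
  by have /andP[] := Vab x.
have -> : (i < k)%N by rewrite -nik addSn ltnS leq_addl.
rewrite add0r.
have c0 : 0 <= l ^+ n / a by rewrite divr_ge0 ?exprn_ge0 ?(ltW a0).
apply: (@le_trans _ _ (rho x (kappa x) (fun y => l ^+ n / a * V y))).
  by apply: le_one_step_risk => y; apply: IH; rewrite addnS.
apply: le_trans (one_step_riskZ _ _ _ _ c0) _.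
apply: le_trans (ler_wpM2l c0 (Vl x)) _.
suff -> : l ^+ n / a * (l * V x) = l ^+ n.+1 / a * V x by [].
by rewrite exprS; ring.
Qed.

Lemma dyn_risk_shift n pi Z k x :
  dyn_risk U A B n (fun h => pi h.+1) (fun h => Z h.+1) k x =
  dyn_risk U A B n pi Z k.+1 x.
Proof.
elim: n k x => //= n IH k x; congr (_ + rho _ _ _).
by apply/funext => y; exact: IH.
Qed.

(** * The optimal cost as a Lyapunov function *)

Section MPC.
Variables (Q P : 'M[K]_Nx) (R : 'M[K]_Nu) (F : 'M[K]_(Nu, Nx)).
Hypotheses (Qpos : posdef Q) (Rpos : posdef R) (Ppos : posdef P).

Lemma stage_cost_ge0 x u : 0 <= stage_cost Q R x u.
Proof. by rewrite addr_ge0 // posdef_ge0. Qed.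

(** For a given [x], the quantity to bound is linear in [q], so the bound at the
vertices suffices. *)
Lemma terminal_decrease :
  (forall q, vertices U q ->
     negdef (\sum_(j < L) q 0 j *: ((A j + B j *m F)^T *m P *m (A j + B j *m F))
             - P + (F^T *m R *m F + Q))) ->
  forall x, stage_cost Q R x (F *m x) + rho x (F *m x) (qform P) <= qform P x.
Proof.
move=> dec x; rewrite -lerBrDl; apply: one_step_risk_le => q Uq.
have [v Vv vmax] := linear_max_at_vertex _ _ U
  (fun j => qform P (A j *m x + B j *m (F *m x))) (@polytope_compact _ _ _ _ SI TI SE TE) U0.
apply: le_trans (vmax q Uq) _.
have := posdef_ge0 _ _ _ x (dec v Vv).
rewrite qformN !qformD qformN qform_lincomb qform_congr /stage_cost.
have -> : \sum_j v 0 j * qform ((A j + B j *m F)^T *m P *m (A j + B j *m F)) x =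
          \sum_j v 0 j * qform P (A j *m x + B j *m (F *m x)).
  by apply: eq_bigr => j _; rewrite qform_congr mulmxDl mulmxA.
by move=> ?; lra.
Qed.

Hypothesis Fdec :
  forall x, stage_cost Q R x (F *m x) + rho x (F *m x) (qform P) <= qform P x.

(** Backward in time, each step under [F] keeps the cost-to-go below the terminal
weight. *)
Lemma mpc_cost_terminal_feedback N x :
  mpc_cost U A B Q R N P x (fun=> mulmx F) <= qform P x.
Proof.
rewrite /mpc_cost.
suff main n k y : (n + k = N)%N -> dyn_risk U A B n (fun=> mulmx F)
    (fun h y => if (h < N)%N then stage_cost Q R y (F *m y) else qform P y)
    k y <= qform P y by apply: main; rewrite addn0.
elim: n k y => [|n IH] k y /= nk; first by rewrite -nk ltnn.
have -> : (k < N)%N by rewrite -nk addSn ltnS leq_addl.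
apply: le_trans (Fdec y); rewrite lerD2l.
by apply: le_one_step_risk => z; apply: IH; rewrite addnS.
Qed.

(** The two costs have the same stages until the last one, where the terminal cost
on the right is replaced on the left by one step under [F] followed by the
terminal cost; monotonicity of [rho] carries [Fdec] back to time 0. *)
Lemma mpc_cost_shifted N pi x :
  mpc_cost U A B Q R N.+1 P x
    (fun h => if (h < N)%N then pi h.+1 else mulmx F) <=
  mpc_cost U A B Q R N P x (fun h => pi h.+1).
Proof.
rewrite /mpc_cost; set pi' := (fun h : nat => _).
suff main n k y : (n + k = N)%N ->
    dyn_risk U A B n.+1 pi'
      (fun h y => if (h < N.+1)%N then stage_cost Q R y (pi' h y)
                  else qform P y) k y <=
    dyn_risk U A B n (fun h => pi h.+1)
      (fun h y => if (h < N)%N then stage_cost Q R y (pi h.+1 y)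
                  else qform P y) k y by apply: main; rewrite addn0.
elim: n k y => [|n IH] k y nk.
  by rewrite /= -nk add0n /pi' ltnSn !ltnn -nk add0n ltnn; exact: Fdec.
have kN : (k < N)%N by rewrite -nk addSn ltnS leq_addl.
rewrite [X in X <= _]/= [X in _ <= X]/= ltnS (ltnW kN) kN {1 2}/pi' kN lerD2l.
by apply: le_one_step_risk => z; apply: IH; rewrite addnS.
Qed.

(** The dynamic programming recursion, for a given policy. *)
Lemma mpc_costS N pi x :
  mpc_cost U A B Q R N.+1 P x pi = stage_cost Q R x (pi 0%N x) +
    rho x (pi 0%N x) (fun y => mpc_cost U A B Q R N P y (fun h => pi h.+1)).
Proof.
rewrite /mpc_cost /=; congr (_ + rho _ _ _).
by apply/funext => y; rewrite -dyn_risk_shift.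
Qed.

Lemma mpc_UGRSES N piMPC : (1 <= N)%N -> mpc_law U A B Q R N P piMPC ->
  UGRSES U A B piMPC.
Proof.
case: N => // N _ law.
have /choice[pi piP] : forall x, exists pi,
    mpc_minimizer U A B Q R N.+1 P x pi /\ piMPC x = pi 0%N x.
  by move=> x; have [pi] := law x; exists pi.
pose V x := mpc_cost U A B Q R N.+1 P x (pi x).
have Vmin x pi' : V x <= mpc_cost U A B Q R N.+1 P x pi' by apply: (piP x).1.
have V_le_P x : V x <= qform P x.
  exact: le_trans (Vmin x _) (mpc_cost_terminal_feedback _ _).
have cost_ge0 n x pi' : 0 <= mpc_cost U A B Q R n P x pi'.
  apply: dyn_risk_ge0 => h y; case: ifP => _; first exact: stage_cost_ge0.
  exact: posdef_ge0.
have Q_le_V x : qform Q x <= V x.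
  rewrite /V mpc_costS -addrA lerDl addr_ge0 ?posdef_ge0 //.
  exact: one_step_risk_ge0.
have V_decr x : rho x (piMPC x) V <= V x - qform Q x.
  have tail : rho x (piMPC x) V <= rho x (piMPC x)
      (fun y => mpc_cost U A B Q R N P y (fun h => pi x h.+1)).
    apply: le_one_step_risk => y.
    by apply: le_trans (Vmin y _) (mpc_cost_shifted N (pi x) y).
  have R0 := posdef_ge0 _ _ R (piMPC x) Rpos.
  by rewrite {2}/V mpc_costS -(piP x).2 /stage_cost; lra.
have [a a0 aQ] := posdef_coercive _ _ _ Qpos.
have [b b0 Pb] := qform_le_sqnorm _ _ P.
(* Adding [a] makes [m] positive and at least [a], so that 0 <= 1 - a / m < 1. *)
pose m := a + b.
have Vm x : V x <= m * sqnorm x.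
  apply: le_trans (V_le_P x) (le_trans (Pb x) _).
  by rewrite ler_wpM2r ?sqnorm_ge0 // lerDr ltW.
have m0 : 0 < m by rewrite ltr_pwDl.
apply: (@lyapunov_UGRSES _ V a m (1 - a / m)) => //.
- exact: ltW.
- by rewrite subr_ge0 ler_pdivrMr // mul1r lerDl b0 /= gtrDl oppr_lt0 divr_gt0.
- by move=> x; rewrite Vm andbT (le_trans (aQ x)).
- move=> x; apply: le_trans (V_decr x) _; rewrite mulrBl mul1r lerD2l lerN2.
  apply: le_trans (aQ x); rewrite mulrAC -mulrA ler_pM2l //.
  by rewrite ler_pdivrMr // mulrC.
Qed.

End MPC.
End Risk.

Theorem mainTheorem2 (K : realType) (Nx Nu L mI mE : nat)
    (A : 'I_L -> 'M[K]_Nx) (B : 'I_L -> 'M[K]_(Nx, Nu))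
    (p : 'rV[K]_L) (hp : positive_pmf p)
    (SI : 'rV[K]_L -> 'M[K]_(mI, L)) (TI : 'rV[K]_L -> 'cV[K]_mI)
    (SE : 'rV[K]_L -> 'M[K]_(mE, L)) (TE : 'rV[K]_L -> 'cV[K]_mE)
    (hU : polytope (SI p) (TI p) (SE p) (TE p) !=set0)
    (Q : 'M[K]_Nx) (R : 'M[K]_Nu) (hQ : posdef Q) (hR : posdef R)
    (N : nat) (hN : (1 <= N)%N)
    (P : 'M[K]_Nx) (hP : posdef P)
    (hF : exists F : 'M[K]_(Nu, Nx),
      forall q, vertices (polytope (SI p) (TI p) (SE p) (TE p)) q ->
        negdef (\sum_(j < L) q 0 j *: ((A j + B j *m F)^T *m P *m (A j + B j *m F))
                - P + (F^T *m R *m F + Q)))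
    (piMPC : 'cV[K]_Nx -> 'cV[K]_Nu)
    (hMPC : mpc_law (polytope (SI p) (TI p) (SE p) (TE p)) A B Q R N P piMPC) :
  UGRSES (polytope (SI p) (TI p) (SE p) (TE p)) A B piMPC.
Proof.
have [F dec] := hF.
apply: (@mpc_UGRSES _ _ _ _ _ _ _ _ _ _ _ _ hU Q P R F hQ hR hP _ N) => //.
by apply: terminal_decrease => //; exact: dec.
Qed.
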